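(* Let $p$ be a prime and let $r,s,k$ be positive integers with $sk=r$ and $k>1$. Let $R=\mathrm{GR}(p^2,r)$ and $S=\mathrm{GR}(p^2,s)$, with $S$ regarded as a subring of $R$. Let $\mathcal{T}$ denote the Teichmuller set of $R$, let $q=p^s$, and let $\pi$ be a permutation of $\mathcal{T}$ that fixes $0$. Write each $x\in R$ uniquely as $x=x_0+px_1$ with $x_0,x_1\in\mathcal{T}$, and define $$f:R\longrightarrow R:\ x\mapsto p\,\pi(x_0)\,x_1 .$$ Then the spectrum of $f$ is $$\Lambda_{f,S}=\left\{\,q^{2k},\ q^{k},\ -\frac{q^k}{q-1},\ 0\,\right\}.$$
   Context: $\mathrm{GR}(p^n,r)$ denotes the Galois ring of characteristic $p^n$ and order $p^{nr}$; it is a finite commutative local Frobenius ring. Its group of units contains a unique cyclic subgroup $G$ of order $p^r-1$, and the Teichmuller set is $\mathcal{T}=G\cup\{0\}$. A (left) generating character of a finite Frobenius ring $S$ is an additive character $\Phi:S\to\mathbb{C}^\times$ such that every additive character of $S$ has the form $x\mapsto\Phi(rx)$ (or, using the other module structure, $x\mapsto \Phi(xr)$) for some $r\in S$. For finite Frobenius rings $R\supseteq S$, a trace map from $R$ onto $S$ is a left $S$-module epimorphism $T:R\to S$ whose kernel contains no non-trivial (i.e. nonzero) left ideal of $R$. Throughout, $T:R\to S$ is a fixed trace map (for Galois rings one exists, e.g. $T_{R/S}(a)=a+\tau(a)+\cdots+\tau^{k-1}(a)$, where $\tau$ generates the group of $S$-automorphisms of $R$), $\Phi$ is a generating character of $S$,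 and $\chi:=\Phi\circ T$. For $u\in S$ write $\chi^u(x)=\chi(ux)$ (the rings here are commutative). For $f:R\to R$ and $\alpha,\beta\in R$ define $$W^{f,S}(\alpha,\beta)=\frac{1}{|S^\times|}\sum_{u\in S^\times}\sum_{x\in R}\chi^u(\alpha x+\beta f(x)),\qquad \Lambda_{f,S}=\{W^{f,S}(\alpha,\beta):\alpha,\beta\in R\},$$ where $S^\times$ is the group of units of $S$. The set $\Lambda_{f,S}$ is called the spectrum of $f$. *)

(* Defs.v *)
From mathcomp Require Import all_boot all_order all_fingroup all_algebra.
From mathcomp Require Import classical_sets.

Set Implicit Arguments.
Unset Strict Implicit.
Unset Printing Implicit Defensive.

Import GRing.Theory Num.Theory.
Local Open Scope ring_scope.

(* GR(p^n, r), up to isomorphism: the finite commutative ring of characteristic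
   p^n and order p^(n r) whose zero divisors, together with 0, form the
   principal ideal generated by p.  (MathComp's [pchar R] only records prime
   characteristics, hence the explicit first clause.) *)
Definition galois_ring (p n r : nat) (R : finComUnitRingType) : Prop :=
  [/\ forall m : nat, (m%:R == 0 :> R) = (p ^ n %| m)%N,
      #|R| = (p ^ (n * r))%N
    & forall x : R, (exists2 y, y != 0 & x * y = 0) <->
                    (exists y, x = p%:R * y)].

Definition teichmuller (R : finComUnitRingType) (G : {group {unit R}}) : {set R} :=
  0 |: [set val g | g in G].

(* The pair (x0, x1) in A x A with x = x0 + p x1; the default (0, 0) is returned
   only if there is no such pair. *)
Definition padic_digits (R : finComUnitRingType) (p : nat) (A : {set R})
    (x : R) : R * R :=
  odflt (0, 0) [pick d | [&& d.1 \in A, d.2 \in A & x == d.1 + p%:R * d.2]].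

Definition teich_fun (R : finComUnitRingType) (p : nat) (A : {set R})
    (pi : R -> R) (x : R) : R :=
  let d := padic_digits p A x in p%:R * pi d.1 * d.2.

Definition additive_character (S : finComUnitRingType) (C : fieldType)
    (psi : S -> C) : Prop :=
  (forall x, psi x != 0) /\ (forall x y, psi (x + y) = psi x * psi y).

Definition generating_character (S : finComUnitRingType) (C : fieldType)
    (Phi : S -> C) : Prop :=
  additive_character Phi /\
  forall psi : S -> C, additive_character psi ->
    exists r : S, forall x, psi x = Phi (r * x).

(* Unlike MathComp's [idealr_closed], this does not require properness. *)
Definition left_ideal (R : finComUnitRingType) (I : {set R}) : Prop :=
  0 \in I /\ forall a, {in I &, forall x y, a * x + y \in I}.

(* R is an S-module through the embedding iota. *)
Definition trace_map (R S : finComUnitRingType) (iota : S -> R) (T : R -> S) : Prop :=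
  [/\ forall x y, T (x + y) = T x + T y,
      forall u x, T (iota u * x) = u * T x,
      forall v, exists x, T x = v
    & forall I : {set R}, left_ideal I -> {in I, forall x, T x = 0} ->
        {in I, forall x, x = 0}].

Definition char_twist (R S : finComUnitRingType) (iota : S -> R) (C : fieldType)
    (chi : R -> C) (u : S) (x : R) : C := chi (iota u * x).

Definition walsh (R S : finComUnitRingType) (iota : S -> R) (C : fieldType)
    (chi : R -> C) (f : R -> R) (alpha beta : R) : C :=
  (#|[set u : S | u \is a GRing.unit]|%:R)^-1 *
  \sum_(u : S | u \is a GRing.unit) \sum_(x : R)
     char_twist iota chi u (alpha * x + beta * f x).

Definition spectrum (R S : finComUnitRingType) (iota : S -> R) (C : fieldType)
    (chi : R -> C) (f : R -> R) : set C :=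
  [set w | exists alpha beta : R, w = walsh iota chi f alpha beta]%classic.

(* Main.v *)
Require Import Defs.
From mathcomp Require Import all_boot all_order all_fingroup all_algebra.
From mathcomp Require Import separable algC cyclotomic classfun character.
From mathcomp Require Import cyclic classical_sets reals complex.

Set Implicit Arguments.
Unset Strict Implicit.
Unset Printing Implicit Defensive.

Import GRing.Theory Num.Theory.
Local Open Scope ring_scope.
Local Open Scope complex_scope.

(** Write x = a + p b with Teichmuller digits a and b, and let P = pR.  Since
    p^2 = 0, the argument of the character splits as
      alpha x + beta f(x) = alpha a + p b (alpha + beta pi(a)),
    so that the sum over b runs the character x |-> chi(u (alpha + beta pi(a)) x)
    over the ideal P.  By orthogonality it is |P| = p^r if alpha + beta pi(a) lies
    in P, and 0 otherwise ([sum_digits_walsh]).  Averaging over the units u of S gives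
      W(alpha, beta) = p^r * sum of M(T(alpha a)) over the digits a such that
                       alpha + beta pi(a) lies in P,
    where M(t) is the mean of Phi(u t) over the units u ([walsh_digit_sum]).

    The units of S are the complement of pS, so M is a difference of two complete
    character sums: M(t) is 1 for t = 0, it is -1/(q-1) for t nonzero in pS, and it is
    0 for the other t ([unit_averageE]).  If beta is a unit, the digits represent R/P
    and pi permutes them, so exactly one a contributes and W(alpha, beta) is
    q^k M(T(alpha a)) ([walsh_unit]).  If beta is in P, then W(alpha, beta) is 0 except
    at alpha = 0, where all p^r digits contribute 1 ([walsh_pideal]).

    The values q^(2k), q^k and 0 are thus taken at simple points; for -q^k/(q-1) one
    needs a unit a of R such that T(a) is nonzero in pS.  If T(b) = 1, then a can be
    p b + z for any unit z of R in ker T.  Such a unit exists: ker T has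
    p^(2r-2s) elements, at least |P| as k > 1, so it could be contained in P only by
    being equal to it, but ker T contains no nonzero ideal ([trace_unit_in_pideal]).

    All orthogonality relations need that Phi is nontrivial on every nonzero ideal of
    S: as every character has the form x |-> Phi(r x), this follows from the fact that
    characters separate the points of S ([additive_character_separates]); T then carries
    the property over to chi, as its kernel contains no nonzero ideal. *)

(** * Additive characters of finite rings *)

Lemma prim_root_exists (C : numClosedFieldType) (n : nat) :
  (0 < n)%N -> exists z : C, n.-primitive_root z.
Proof.
move=> n_gt0; pose P : {poly C} := 'X^n - 1.
have [s defP] := closed_field_poly_normal P.
rewrite (monicP _) ?monicXnsubC // scale1r in defP.
have s1 : all n.-unity_root s.
  by apply/allP => z; rewrite -root_prod_XsubC -defP.
have size_s : (n <= size s)%N.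
  by rewrite -ltnS -(size_prod_XsubC s id) -defP size_XnsubC.
have uniq_s : uniq s.
  by rewrite -separable_prod_XsubC -defP separable_Xn_sub_1 // pnatr_eq0 -lt0n.
by have /hasP[z _ prim_z] := has_prim_root n_gt0 s1 uniq_s size_s; exists z.
Qed.

(** The linear characters of the finite abelian group S separate its points, but
    have values in the algebraic numbers.  Their values are powers of a primitive root
    of unity of order #|S|, so they can be copied into any C that has such a root. *)
Lemma additive_character_separates (C : numClosedFieldType)
    (S : finComUnitRingType) (t : S) :
  t != 0 -> exists psi : S -> C, additive_character psi /\ psi t != 1.
Proof.
move=> t0; pose H := [set: S]%G.
have [i ti] : exists i : Iirr H, 'chi_i t != 1.
  apply/existsP; rewrite -negb_forall; apply: contra t0 => /forallP chit1.
  have : t \in [1 S]%g.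
    rewrite -(TI_cfker_irr H); apply/bigcapP => i _.
    have lin_i : 'chi_i \is a linear_char by apply/char_abelianP/FinRing.zmod_abelian.
    by rewrite cfkerEirr inE (lin_char1 lin_i).
  by rewrite inE.
have lin_i : 'chi_i \is a linear_char by apply/char_abelianP/FinRing.zmod_abelian.
have n_gt0 : (0 < #|H|)%N := cardG_gt0 H.
have [z prim_z] := C_prim_root_exists n_gt0.
have [w prim_w] := prim_root_exists C n_gt0.
have chi_n x : 'chi_i x ^+ #|H| = 1.
  by rewrite -lin_charX ?expg_cardG ?inE // lin_char1.
pose e x := sval (prim_rootP prim_z (chi_n x)).
have eE x : 'chi_i x = z ^+ e x by rewrite /e; case: (prim_rootP _ _).
exists (fun x => w ^+ e x); split; last first.
  apply: contra ti; rewrite eE -(expr0 w) -(expr0 z).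
  by rewrite (eq_prim_root_expr prim_w) (eq_prim_root_expr prim_z).
split=> [x | x y].
  by rewrite expf_neq0 // (prim_root_eq0 prim_w) -lt0n.
apply/eqP; rewrite -exprD (eq_prim_root_expr prim_w) -(eq_prim_root_expr prim_z).
by rewrite exprD -!eE -(lin_charM lin_i) ?inE.
Qed.

Section Characters.

Variables (S : finComUnitRingType) (C : fieldType) (psi : S -> C).
Hypothesis psi_char : additive_character psi.

Lemma additive_character0 : psi 0 = 1.
Proof.
have [nz psiD] := psi_char; apply: (mulfI (nz 0)).
by rewrite -psiD addr0 mulr1.
Qed.

Lemma additive_characterM (c : S) : additive_character (fun x => psi (x * c)).
Proof.
by have [nz psiD] := psi_char; split=> [x | x y]; rewrite ?nz // mulrDl psiD.
Qed.

(** Translation by z permutes A and multiplies the sum by psi z. *)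
Lemma sum_character_translate (A : {set S}) (z : S) :
    (forall x, (z + x \in A) = (x \in A)) -> psi z != 1 ->
  \sum_(x in A) psi x = 0.
Proof.
move=> Az psiz; have [_ psiD] := psi_char.
have : (psi z - 1) * \sum_(x in A) psi x = 0.
  rewrite mulrBl mul1r; apply/eqP; rewrite subr_eq0; apply/eqP.
  rewrite mulr_sumr [RHS](reindex_inj (addrI z)) /=.
  by apply: eq_big => x; rewrite ?Az ?psiD.
by move/eqP; rewrite mulf_eq0 subr_eq0 (negPf psiz) => /eqP.
Qed.

End Characters.

Lemma generating_character_nondegenerate (C : numClosedFieldType)
    (S : finComUnitRingType) (Phi : S -> C) (t : S) :
  generating_character Phi -> t != 0 -> exists u, Phi (u * t) != 1.
Proof.
move=> [_ Phi_gen] /(@additive_character_separates C)[psi [/Phi_gen[u psiE]]].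
by rewrite psiE; exists u.
Qed.

(** The order formula for an additive map: all its nonempty fibres are translates of
    the kernel. *)
Lemma card_image_kernel (V W : finZmodType) (h : V -> W) :
    {morph h : x y / x + y} ->
  (#|[set h x | x : V]| * #|[set x | h x == 0%R]|)%N = #|V|.
Proof.
move=> hD; rewrite -[#|V|]sum1_card (partition_big_imset h) /= -sum_nat_const.
apply: eq_bigr => _ /imsetP[a _ ->].
rewrite -[LHS]sum1_card [RHS](reindex_inj (addrI a)) /=; apply: eq_bigl => x.
by rewrite inE hD -[X in _ = (_ == X)]addr0 (inj_eq (addrI _)).
Qed.

(** * Galois rings of characteristic p^2 *)

Definition pideal (R : finComUnitRingType) (p : nat) : {set R} :=
  [set p%:R * y | y : R].

Lemma pidealP (R : finComUnitRingType) (p : nat) (x : R) :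
  reflect (exists y, x = p%:R * y) (x \in pideal R p).
Proof.
by apply: (iffP imsetP) => [[y _ ->] | [y ->]]; exists y.
Qed.

Lemma pidealM (R : finComUnitRingType) (p : nat) (c x : R) :
  x \in pideal R p -> c * x \in pideal R p.
Proof. by move=> /pidealP[y ->]; apply/pidealP; exists (c * y); rewrite mulrCA. Qed.

Lemma pidealD (R : finComUnitRingType) (p : nat) (x y : R) :
  x \in pideal R p -> (x + y \in pideal R p) = (y \in pideal R p).
Proof.
move=> /pidealP[a ->]; apply/pidealP/pidealP => [[b ab] | [b ->]].
  by exists (b - a); rewrite mulrBr -ab addrC addKr.
by exists (a + b); rewrite mulrDr.
Qed.

Lemma pideal0 (R : finComUnitRingType) (p : nat) : 0 \in pideal R p.
Proof. by apply/pidealP; exists 0; rewrite mulr0. Qed.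

Section GaloisRing.

Variables (p r : nat) (R : finComUnitRingType).
Hypotheses (p_prime : prime p) (R_GR : galois_ring p 2 r R).
Local Notation P := (pideal R p).

Lemma galois_p_neq0 : p%:R != 0 :> R.
Proof.
have [-> _ _] := R_GR; apply/negP => /(dvdn_leq (prime_gt0 p_prime)).
by rewrite leqNgt -{1}(expn1 p) ltn_exp2l ?prime_gt1.
Qed.

Lemma galois_psqr0 : p%:R * p%:R = 0 :> R.
Proof. by apply/eqP; have [R0 _ _] := R_GR; rewrite -natrM mulnn R0. Qed.

Lemma mulp_eq0 (x : R) : (p%:R * x == 0) = (x \in P).
Proof.
have [_ _ zero_div] := R_GR; apply/eqP/pidealP => [px0 | [y ->]].
  by apply/zero_div; exists p%:R; rewrite ?galois_p_neq0 // mulrC.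
by rewrite mulrA galois_psqr0 mul0r.
Qed.

(** In a finite ring, x is a unit as soon as multiplication by x is injective, that is,
    as soon as x does not divide zero. *)
Lemma galois_unitE (x : R) : (x \is a GRing.unit) = (x \notin P).
Proof.
have [_ _ zero_div] := R_GR; apply/idP/idP => [Ux | ].
  apply/negP => /pidealP /zero_div[y /negP y0 xy]; apply: y0.
  by rewrite -(mulrI_eq0 y (mulrI Ux)) xy.
move=> xP; have x_inj : injective ( *%R x).
  move=> a b /= xab; apply/eqP; rewrite -subr_eq0; apply: contraNT xP => ab0.
  by apply/pidealP/zero_div; exists (a - b); rewrite // mulrBr xab subrr.
by apply/unitrPr; exists (invF x_inj 1); apply: (f_invF x_inj).
Qed.

(** P is both the image and the kernel of multiplication by p, so #|P| ^ 2 = #|R|. *)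
Lemma card_pideal : #|P| = (p ^ r)%N.
Proof.
have [_ cardR _] := R_GR.
have := card_image_kernel (mulrDr (p%:R : R)).
have -> : [set x : R | p%:R * x == 0] = P by apply/setP => x; rewrite inE mulp_eq0.
rewrite cardR -/(pideal R p) mul2n -addnn expnD !mulnn => /eqP.
by rewrite eqn_exp2r // => /eqP.
Qed.

Lemma card_galois_units :
  #|[set u : R | u \is a GRing.unit]| = (p ^ r * (p ^ r - 1))%N.
Proof.
have [_ cardR _] := R_GR.
have -> : [set u : R | u \is a GRing.unit] = ~: P.
  by apply/setP => x; rewrite !inE galois_unitE.
by rewrite cardsCs finset.setCK cardR card_pideal mul2n -addnn expnD mulnBr muln1.
Qed.

Section CharacterSums.

Variables (C : fieldType) (psi : R -> C).
Hypothesis (psi_char : additive_character psi).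
Hypothesis psi_nondeg : forall t, t != 0 -> exists z, psi (z * t) != 1.

Lemma sum_pideal (t : R) :
  \sum_(x in P) psi (x * t) = if t \in P then (p ^ r)%:R else 0.
Proof.
have psit := additive_characterM psi_char t.
case: ifP => [tP | /negbT tP].
  rewrite -card_pideal -sum1_card natr_sum; apply: eq_bigr => x /pidealP[y ->].
  rewrite -mulrA mulrCA; move: tP; rewrite -mulp_eq0 => /eqP ->.
  by rewrite mulr0 (additive_character0 psi_char).
have [|z psiz] := @psi_nondeg (p%:R * t); first by rewrite mulp_eq0.
apply: (sum_character_translate psit (z := p%:R * z)) => [x|].
  by rewrite pidealD //; apply/pidealP; exists z.
by rewrite -mulrA mulrCA.
Qed.

(** The units are the complement of P, and the sum over all of R vanishes unless
    t = 0; hence what is left for t != 0 is minus the sum over P. *)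
Lemma sum_units (t : R) :
  \sum_(u : R | u \is a GRing.unit) psi (u * t) =
    if t == 0 then (p ^ r)%:R * ((p ^ r)%:R - 1)
    else if t \in P then - (p ^ r)%:R else 0.
Proof.
have [-> | t0] := eqVneq t 0.
  under eq_bigr do rewrite mulr0 (additive_character0 psi_char).
  rewrite sumr_const -[LHS]mulr_natr mul1r -cardsE card_galois_units natrM natrB //.
  by rewrite expn_gt0 prime_gt0.
have psit := additive_characterM psi_char t.
have [z psiz] := psi_nondeg t0.
have : \sum_(x in [set: R]) psi (x * t) = 0.
  by apply: (sum_character_translate psit _ psiz) => x; rewrite !inE.
rewrite (bigID (mem P)) /=.
under eq_bigl do rewrite inE.
under [X in _ + X]eq_bigl do rewrite inE -galois_unitE.
rewrite sum_pideal; case: ifP => _; last by rewrite add0r.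
by move=> /eqP; rewrite addrC addr_eq0 => /eqP.
Qed.

End CharacterSums.

(** * Teichmuller digits *)

Section Teichmuller.

Variable G : {group {unit R}}.
Hypothesis G_order : #|G| = (p ^ r - 1)%N.
Local Notation A := (teichmuller G).

Lemma exp_1Dp (y : R) (n : nat) : (1 + p%:R * y) ^+ n = 1 + n%:R * (p%:R * y).
Proof.
elim: n => [|n IHn]; first by rewrite expr0 mul0r addr0.
rewrite exprS IHn mulrDl mul1r mulrDr mulr1.
have -> : p%:R * y * (n%:R * (p%:R * y)) = p%:R * p%:R * (y * n%:R * y).
  by rewrite !mulrA -!(mulrAC _ p%:R).
by rewrite galois_psqr0 mul0r addr0 -addrA -{2}[p%:R * y]mul1r -mulrDl natr1.
Qed.

Hypothesis r_gt0 : (0 < r)%N.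

(** The units congruent to 1 modulo p have order dividing p, which is prime to #|G|. *)
Lemma principal_unit_trivial (g : {unit R}) :
  g \in G -> val g - 1 \in P -> g = 1%g.
Proof.
move=> gG /pidealP[y gy]; apply/eqP; rewrite -order_eq1 -dvdn1.
have gp : (g ^+ p = 1)%g.
  apply: val_inj; rewrite FinRing.val_unitX /= -[val g](subrK 1) gy addrC exp_1Dp.
  by rewrite mulrA galois_psqr0 mul0r addr0.
have co : coprime p (p ^ r - 1).
  by rewrite subn1 -(prednK r_gt0) (coprime_dvdl (dvdn_exp2l p (ltn0Sn r.-1))) //
     coprimenP ?expn_gt0 ?prime_gt0.
rewrite -(eqP co) dvdn_gcd order_dvdn gp eqxx /=.
by rewrite -G_order order_dvdG.
Qed.

Lemma teichmuller_unit (a : R) :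
  a \in A -> a != 0 -> exists2 g, g \in G & a = val g.
Proof. by rewrite !inE => /orP[-> // | /imsetP[g gG ->]] _; exists g. Qed.

Lemma teichmuller0 : 0 \in A. Proof. by rewrite !inE eqxx. Qed.

Lemma teichmuller1 : 1 \in A.
Proof. by rewrite !inE; apply/orP; right; apply/imsetP; exists 1%g. Qed.

Lemma teichmuller_pideal (a : R) : a \in A -> a \in P -> a = 0.
Proof.
move=> aA aP; apply/eqP; apply: contraTT aP => a0.
have [g _ ->] := teichmuller_unit aA a0.
by rewrite -galois_unitE (valP g).
Qed.

Lemma teichmuller_inj (a b : R) : a \in A -> b \in A -> a - b \in P -> a = b.
Proof.
move=> aA bA; have [-> | b0] := eqVneq b 0.
  by rewrite subr0; apply: teichmuller_pideal.
have [-> | a0] := eqVneq a 0.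
  rewrite sub0r => bP; rewrite (teichmuller_pideal bA) //.
  by rewrite -[b]opprK -mulN1r pidealM.
have [g gG ->] := teichmuller_unit aA a0; have [h hG ->] := teichmuller_unit bA b0.
move=> gh; congr val; apply/eqP; rewrite eq_mulgV1; apply/eqP.
apply: principal_unit_trivial; first by rewrite groupM ?groupV.
rewrite FinRing.val_unitM FinRing.val_unitV /=.
have Uh : val h \is a GRing.unit by exact: (valP h).
by rewrite -(divrr Uh) -mulrBl mulrC pidealM.
Qed.

Lemma card_teichmuller : #|A| = (p ^ r)%N.
Proof.
rewrite /teichmuller cardsU1 card_imset; last exact: val_inj.
rewrite G_order; case: imsetP => [[g _ g0] | _] /=; last first.
  by rewrite subnKC // expn_gt0 prime_gt0.
by have := valP g; rewrite -g0 unitr0.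
Qed.

Lemma digits_inj :
  {in finset.setX A A &, injective (fun d : R * R => d.1 + p%:R * d.2)}.
Proof.
move=> [a b] [a' b'] /finset.setXP[/= aA bA] /finset.setXP[/= aA' bA'] /= eq_ab.
have eq_a : a = a'.
  apply: teichmuller_inj => //; apply/pidealP; exists (b' - b).
  have -> : a = a' + p%:R * b' - p%:R * b by rewrite -eq_ab addrK.
  by rewrite addrC -!addrA addKr mulrBr.
rewrite eq_a in eq_ab *; congr (_, _); apply: teichmuller_inj => //.
by rewrite -mulp_eq0 mulrBr subr_eq0 (addrI _ eq_ab).
Qed.

(** An injection between two sets with p ^ (2 r) elements is onto. *)
Lemma digits_surj :
  [set d.1 + p%:R * d.2 | d in finset.setX A A] = [set: R].
Proof.
have [_ cardR _] := R_GR.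
apply/eqP; rewrite eqEcard finset.subsetT /= (card_in_imset digits_inj) cardsX.
by rewrite !card_teichmuller cardsT cardR mul2n -addnn expnD.
Qed.

Lemma digitsP (x : R) : exists a b, [/\ a \in A, b \in A & x = a + p%:R * b].
Proof.
have : x \in [set: R] by [].
by rewrite -digits_surj => /imsetP[[a b] /finset.setXP[aA bA] ->]; exists a, b.
Qed.

Lemma padic_digitsE (a b : R) :
  a \in A -> b \in A -> padic_digits p A (a + p%:R * b) = (a, b).
Proof.
move=> aA bA; rewrite /padic_digits; case: pickP => [[c d] | /(_ (a, b))] /=.
  case/and3P=> cA dA /eqP cd; apply: (@digits_inj (c, d) (a, b)) => //.
    by apply/finset.setXP.
  by apply/finset.setXP.
by rewrite aA bA eqxx.
Qed.

Lemma sum_digits (C : nmodType) (F : R -> C) :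
  \sum_x F x = \sum_(a in A) \sum_(b in A) F (a + p%:R * b).
Proof.
rewrite pair_big /=.
transitivity (\sum_(x in [set: R]) F x); first by apply: eq_bigl => x; rewrite inE.
rewrite -digits_surj (big_imset _ digits_inj) /=.
by apply: eq_bigl => d; rewrite !inE.
Qed.

Section Walsh.

Variables (C : fieldType) (chi : R -> C).
Hypothesis (chi_char : additive_character chi).
Hypothesis chi_nondeg : forall t, t != 0 -> exists z, chi (z * t) != 1.

(** Multiplication by p maps the Teichmuller set bijectively onto P. *)
Lemma sum_teichmuller_p (c : R) :
  \sum_(b in A) chi (c * (p%:R * b)) = if c \in P then (p ^ r)%:R else 0.
Proof.
rewrite -(sum_pideal chi_char chi_nondeg).
have p_inj : {in A &, injective ( *%R (p%:R : R))}.
  move=> a b aA bA /= pab; apply: teichmuller_inj => //.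
  by rewrite -mulp_eq0 mulrBr pab subrr.
have -> : P = [set p%:R * b | b in A].
  apply/esym/eqP; rewrite eqEcard (card_in_imset p_inj) card_teichmuller card_pideal.
  rewrite leqnn andbT; apply/fintype.subsetP => _ /imsetP[b _ ->].
  by apply/pidealP; exists b.
by rewrite (big_imset _ p_inj); apply: eq_bigr => b _; rewrite [RHS]/= mulrC.
Qed.

Variables (pi : R -> R) (alpha beta v : R).
Hypothesis Uv : v \is a GRing.unit.

(** The inner sum over the second digit is a complete character sum over P; it keeps
    only the first digits a for which alpha + beta pi(a) is in P. *)
Lemma sum_digits_walsh :
  \sum_x chi (v * (alpha * x + beta * teich_fun p A pi x)) =
  (p ^ r)%:R * \sum_(a in A | alpha + beta * pi a \in P) chi (v * alpha * a).
Proof.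
have [_ chiD] := chi_char; rewrite sum_digits big_mkcondr /= mulr_sumr.
apply: eq_bigr => a aA.
transitivity (chi (v * alpha * a) *
    \sum_(b in A) chi (v * (alpha + beta * pi a) * (p%:R * b))).
  rewrite mulr_sumr; apply: eq_bigr => b bA.
  rewrite -chiD /teich_fun (padic_digitsE aA bA) /=; congr chi.
  rewrite !mulrDr !mulrDl !mulrA -!addrA; congr (_ + (_ + _)).
  by rewrite -!mulrA; do 2 congr (_ * _); rewrite mulrCA.
rewrite sum_teichmuller_p.
have -> : (v * (alpha + beta * pi a) \in P) = (alpha + beta * pi a \in P).
  apply/idP/idP => [vP | /pidealM //].
  by rewrite -[X in X \in _](mulKr Uv) pidealM.
by case: ifP => _; rewrite ?mulr0 // mulrC.
Qed.

End Walsh.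

End Teichmuller.

End GaloisRing.

(** * Trace maps *)

Section Trace.

Variables (R S : finComUnitRingType) (iota : {rmorphism S -> R}) (T : R -> S).
Hypothesis T_trace : trace_map iota T.

Lemma trace0 : T 0 = 0.
Proof.
by have [TD _ _ _] := T_trace; apply: (addrI (T 0)); rewrite -TD !addr0.
Qed.

Lemma trace_natM (n : nat) (x : R) : T (n%:R * x) = n%:R * T x.
Proof. by have [_ TZ _ _] := T_trace; rewrite -TZ rmorph_nat. Qed.

Lemma trace_character (C : fieldType) (Phi : S -> C) :
  additive_character Phi -> additive_character (Phi \o T).
Proof.
move=> [nz PhiD]; have [TD _ _ _] := T_trace.
by split=> [x | x y] /=; rewrite ?nz // TD PhiD.
Qed.

(** Otherwise the nonzero ideal generated by t would lie in the kernel of T. *)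
Lemma trace_nondegenerate (t : R) : t != 0 -> exists z, T (z * t) != 0.
Proof.
move=> t0; have [TD _ _ T_ideal] := T_trace.
apply/existsP; apply: contraNT t0; rewrite negb_exists => /forallP Tt0.
apply/eqP; apply: (T_ideal [set z * t | z : R]).
- split=> [|a _ _ /imsetP[y _ ->] /imsetP[z _ ->]].
    by apply/imsetP; exists 0; rewrite ?mul0r.
  by apply/imsetP; exists (a * y + z); rewrite // mulrDl mulrA.
- by move=> _ /imsetP[z _ ->]; apply/eqP; rewrite -[_ == _]negbK Tt0.
- by apply/imsetP; exists 1; rewrite ?mul1r.
Qed.

Lemma trace_character_nondegenerate (C : numClosedFieldType) (Phi : S -> C) (t : R) :
  generating_character Phi -> t != 0 -> exists z, (Phi \o T) (z * t) != 1.
Proof.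
move=> Phi_gen /trace_nondegenerate[z].
move=> /(generating_character_nondegenerate Phi_gen)[u].
have [_ TZ _ _] := T_trace.
by rewrite -TZ mulrA; exists (iota u * z).
Qed.

Variables (p r s : nat).
Hypotheses (p_prime : prime p) (R_GR : galois_ring p 2 r R).
Hypothesis S_GR : galois_ring p 2 s S.

(** The fibre of T over p is a translate of its kernel N by an element of pR, so it
    contains a unit as soon as N is not contained in pR.  The bound 2 s <= r makes N at
    least as large as pR; were N contained in pR, it would be the nonzero ideal pR. *)
Lemma trace_unit_in_pideal :
  (2 * s <= r)%N ->
  exists a : R, [/\ a \is a GRing.unit, T a != 0 & T a \in pideal S p].
Proof.
move=> s_le_r; have [TD _ T_onto T_ideal] := T_trace.
have [_ cardR _] := R_GR; have [_ cardS _] := S_GR.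
pose N := [set x | T x == 0].
have cardN : (p ^ (2 * s) * #|N| = p ^ (2 * r))%N.
  rewrite -cardR -(card_image_kernel TD) -cardS -cardsT; congr (#|pred_of_set _| * _)%N.
  apply/esym/setP => v; rewrite inE; apply/imsetP.
  by have [x <-] := T_onto v; exists x.
have [z zN zP] : exists2 z, z \in N & z \notin pideal R p.
  apply/fintype.subsetPn; apply/negP => NP.
  have eNP : N = pideal R p.
    apply/eqP; rewrite eqEcard NP (card_pideal p_prime R_GR).
    have ps : (0 < p ^ (2 * s))%N by rewrite expn_gt0 prime_gt0.
    rewrite -(leq_pmul2l ps) cardN -expnD leq_exp2l ?prime_gt1 //.
    by rewrite [leqRHS]mul2n -addnn leq_add2r.
  suff p0 : p%:R = 0 :> R by have := galois_p_neq0 p_prime R_GR; rewrite p0 eqxx.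
  apply: (T_ideal N).
  - rewrite eNP; split=> [|a x y xP yP]; first exact: pideal0.
    by rewrite pidealD // pidealM.
  - by move=> x; rewrite inE => /eqP.
  - by rewrite eNP; apply/pidealP; exists 1; rewrite mulr1.
have [b Tb] := T_onto 1; exists (p%:R * b + z).
have -> : T (p%:R * b + z) = p%:R.
  by move: zN; rewrite inE TD trace_natM Tb mulr1 => /eqP ->; rewrite addr0.
split; last by apply/pidealP; exists 1; rewrite mulr1.
  by rewrite (galois_unitE R_GR) pidealD //; apply/pidealP; exists b.
exact: galois_p_neq0 p_prime S_GR.
Qed.

(** * Walsh coefficients of the digit function *)

Definition unit_average (C : fieldType) (Phi : S -> C) (t : S) : C :=
  (#|[set u : S | u \is a GRing.unit]|%:R)^-1 *
    \sum_(u : S | u \is a GRing.unit) Phi (u * t).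

Variables (C : numClosedFieldType) (Phi : S -> C).
Hypothesis Phi_gen : generating_character Phi.
Local Notation q := ((p ^ s)%:R : C).

Lemma unit_average0 : unit_average Phi 0 = 1.
Proof.
have [Phi_char _] := Phi_gen; rewrite /unit_average.
under eq_bigr do rewrite mulr0 (additive_character0 Phi_char).
rewrite sumr_const cardsE mulVf // pnatr_eq0 -lt0n.
by apply/card_gt0P; exists 1; exact: unitr1.
Qed.

Lemma unit_averageE (t : S) :
  (0 < s)%N ->
  unit_average Phi t =
    if t == 0 then 1 else if t \in pideal S p then - (q - 1)^-1 else 0.
Proof.
move=> s_gt0; have [-> | t0] := eqVneq t 0; first exact: unit_average0.
have [Phi_char _] := Phi_gen.
have ps_gt0 : (0 < p ^ s)%N by rewrite expn_gt0 prime_gt0.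
have q_neq0 : q != 0 by rewrite pnatr_eq0 -lt0n.
have q1_neq0 : q - 1 != 0.
  by rewrite subr_eq0 -[1]/(1%:R) eqr_nat -(expn0 p) eqn_exp2l ?prime_gt1 // -lt0n.
rewrite /unit_average (card_galois_units p_prime S_GR) natrM natrB //.
rewrite (sum_units p_prime S_GR Phi_char); last first.
  by move=> x; apply: generating_character_nondegenerate.
rewrite (negPf t0); case: ifP => _; last by rewrite mulr0.
by rewrite invfM mulrN mulrAC mulVf // mul1r.
Qed.

Variables (G : {group {unit R}}) (pi : R -> R).
Hypotheses (G_order : #|G| = (p ^ r - 1)%N) (r_gt0 : (0 < r)%N).
Local Notation A := (teichmuller G).
Local Notation W := (walsh iota (Phi \o T) (teich_fun p A pi)).

Lemma walsh_digit_sum (alpha beta : R) :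
  W alpha beta =
  (p ^ r)%:R * \sum_(a in A | alpha + beta * pi a \in pideal R p)
                  unit_average Phi (T (alpha * a)).
Proof.
have [Phi_char _] := Phi_gen; have [_ TZ _ _] := T_trace.
rewrite /walsh /unit_average -mulr_sumr [RHS]mulrCA; congr (_ * _).
rewrite [X in _ = _ * X]exchange_big mulr_sumr /=; apply: eq_bigr => u Uu.
rewrite /char_twist (sum_digits_walsh p_prime R_GR G_order r_gt0) ?rmorph_unit //.
- by congr (_ * _); apply: eq_bigr => a _ /=; rewrite -mulrA TZ.
- exact: trace_character.
- by move=> t; apply: trace_character_nondegenerate.
Qed.

(** Dividing by beta shows that all solutions a of alpha + beta pi(a) = 0 modulo p have
    the same pi(a) modulo p; distinct Teichmuller elements are not congruent. *)
Lemma walsh_unit (alpha beta a : R) :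
    {in A &, injective pi} -> {in A, forall b, pi b \in A} ->
    beta \is a GRing.unit -> a \in A -> alpha + beta * pi a \in pideal R p ->
  W alpha beta = (p ^ r)%:R * unit_average Phi (T (alpha * a)).
Proof.
move=> pi_inj piA Ubeta aA aP; rewrite walsh_digit_sum (big_pred1 a) // => b /=.
apply/andP/eqP => [[bA bP] | -> //]; apply: pi_inj => //.
apply: (teichmuller_inj p_prime R_GR G_order r_gt0); rewrite ?piA //.
rewrite -(mulKr Ubeta (pi b - pi a)) pidealM //.
have -> : beta * (pi b - pi a) =
    - 1 * (alpha + beta * pi a) + (alpha + beta * pi b).
  by rewrite mulrBr mulN1r opprD addrACA addNr add0r addrC.
by rewrite pidealD // pidealM.
Qed.

(** The condition on a reduces to alpha being in pR.  If alpha = p c, then alpha a runs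
    over the ideal p c R, and the character sum over it is 0 unless the ideal is. *)
Lemma walsh_pideal (alpha beta : R) :
    beta \in pideal R p ->
  W alpha beta = if alpha == 0 then (p ^ r)%:R ^+ 2 else 0.
Proof.
move=> betaP; have [Phi_char _] := Phi_gen; have [_ TZ _ _] := T_trace.
have condE a : (alpha + beta * pi a \in pideal R p) = (alpha \in pideal R p).
  by rewrite addrC pidealD // mulrC pidealM.
rewrite walsh_digit_sum; under eq_bigl do rewrite condE.
have [-> | alpha0] := eqVneq alpha 0.
  rewrite (eq_bigl (mem A)) => [|a]; last by rewrite pideal0 andbT.
  under eq_bigr do rewrite mul0r trace0 unit_average0.
  by rewrite sumr_const (card_teichmuller p_prime G_order) expr2.
have [/pidealP[c alphaE] | alphaP] := boolP (alpha \in pideal R p); last first.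
  by rewrite big_pred0 ?mulr0 // => a; rewrite andbF.
rewrite -mulr_sumr exchange_big big1 ?mulr0 // => u Uu.
transitivity (\sum_(a in A) (Phi \o T) (iota u * c * (p%:R * a))).
  apply: eq_big => a; rewrite ?andbT // => _ /=.
  rewrite -TZ alphaE; congr (Phi (T _)).
  by rewrite -!mulrA; congr (_ * _); rewrite mulrCA.
rewrite (sum_teichmuller_p p_prime R_GR G_order r_gt0 (trace_character Phi_char)).
  case: ifP => // /(pidealM (iota u)^-1); rewrite mulKr ?rmorph_unit //.
  by rewrite -(mulp_eq0 p_prime R_GR) -alphaE (negPf alpha0).
by move=> t; apply: trace_character_nondegenerate.
Qed.

End Trace.

(** * The spectrum *)

Theorem theorem5p1 (K : realType) (p r s k : nat)
    (p_prime : prime p) (r_gt0 : (0 < r)%N) (s_gt0 : (0 < s)%N)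
    (sk : (s * k = r)%N) (k_gt1 : (1 < k)%N)
    (R S : finComUnitRingType)
    (R_GR : galois_ring p 2 r R) (S_GR : galois_ring p 2 s S)
    (iota : {rmorphism S -> R}) (iota_inj : injective iota)
    (T : R -> S) (T_trace : trace_map iota T)
    (Phi : S -> K[i]) (Phi_gen : generating_character Phi)
    (G : {group {unit R}}) (G_cyclic : cyclic G)
    (G_order : #|G| = (p ^ r - 1)%N)
    (pi : {perm R}) (pi_perm : perm_on (teichmuller G) pi) (pi0 : pi 0 = 0) :
  let f : R -> R := teich_fun p (teichmuller G) pi in
  let chi : R -> K[i] := Phi \o T in
  let q : K[i] := (p ^ s)%:R in
  spectrum iota chi f =
    [set q ^+ (2 * k); q ^+ k; - (q ^+ k / (q - 1)); 0]%classic.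
Proof.
move=> f chi q.
have piA a : (pi a \in teichmuller G) = (a \in teichmuller G) by apply: perm_closed.
have qk : (p ^ r)%:R = q ^+ k by rewrite -sk expnM natrX.
have walshP alpha beta : beta \in pideal R p ->
    walsh iota chi f alpha beta = if alpha == 0 then q ^+ (2 * k) else 0.
  move=> betaP; rewrite (walsh_pideal T_trace p_prime R_GR Phi_gen) //.
  by rewrite qk -exprM mulnC.
have walshU alpha beta a : beta \is a GRing.unit -> a \in teichmuller G ->
    alpha + beta * pi a \in pideal R p ->
    walsh iota chi f alpha beta =
      if T (alpha * a) == 0 then q ^+ k
      else if T (alpha * a) \in pideal S p then - (q ^+ k / (q - 1)) else 0.
  move=> Ubeta aA aP.
  rewrite (walsh_unit T_trace p_prime R_GR Phi_gen G_order r_gt0 _ _ Ubeta aA aP).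
  - rewrite (unit_averageE p_prime S_GR Phi_gen) // qk.
    by case: ifP => _; [rewrite mulr1 | case: ifP => _; rewrite ?mulrN ?mulr0].
  - by move=> b c _ _ /perm_inj.
  - by move=> b; rewrite piA.
apply/seteqP; split=> w.
  move=> [alpha [beta ->]] /=.
  have [Ubeta | Nbeta] := boolP (beta \is a GRing.unit); last first.
    rewrite walshP; last by rewrite -[_ \in _]negbK -(galois_unitE R_GR).
    by case: ifP => _; [do 3 left | right].
  have [a [c [aA _ acE]]] := digitsP p_prime R_GR G_order r_gt0 (- alpha / beta).
  rewrite (walshU _ _ ((pi^-1)%g a) Ubeta); last 1 first.
  - apply/pidealP; exists (- beta * c); rewrite permKV.
    have -> : alpha = - beta * (a + p%:R * c).
      by rewrite -acE mulNr mulrCA divrr // mulr1 opprK.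
    by rewrite mulrDr mulNr addrAC addNr add0r mulrCA.
  - by case: ifP => _; [|case: ifP => _]; [left; left; right | left; right | right].
  - by rewrite -piA permKV.
have U1 : pi 1 \is a GRing.unit.
  have pi1A : pi 1 \in teichmuller G by rewrite piA teichmuller1.
  rewrite (galois_unitE R_GR); apply/negP => /(teichmuller_pideal R_GR pi1A).
  by rewrite -[RHS]pi0 => /perm_inj/eqP; rewrite oner_eq0.
case=> [[[|]|]|] ->.
- by exists 0, 0; rewrite walshP ?pideal0 ?eqxx.
- exists 0, 1; rewrite (walshU _ _ 0) ?unitr1 ?teichmuller0 //.
    by rewrite mulr0 (trace0 T_trace) eqxx.
  by rewrite pi0 mulr0 addr0 pideal0.
- have s_le_r : (2 * s <= r)%N by rewrite -sk mulnC leq_pmul2l.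
  have [a [Ua Ta0 TaP]] := trace_unit_in_pideal T_trace p_prime R_GR S_GR s_le_r.
  (* beta is chosen so that alpha + beta pi(1) = 0: the contributing digit is 1 *)
  exists a, (- a / pi 1); rewrite (walshU _ _ 1) ?teichmuller1 //.
  + by rewrite mulr1 (negPf Ta0) TaP.
  + by rewrite unitrMl ?unitrN // unitrV.
  + by rewrite divrK // subrr pideal0.
- by exists 1, 0; rewrite walshP ?pideal0 ?oner_eq0.
Qed.
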